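(* Let $\mathcal{L}u=-\kappa(x)\frac{\mathrm d}{\mathrm dx}\left(\frac{1}{\rho(x)}\frac{\mathrm du}{\mathrm dx}\right)$ be the one-dimensional $1$-periodic operator described in the context, let $\sigma(\mathcal{L})=\bigcup_{\alpha\in[-\pi,\pi]}\sigma(\mathcal{L}(\alpha))\subset\mathbb{R}$ be its spectrum, and let $\rho(\mathcal{L}):=\mathbb{R}\setminus\sigma(\mathcal{L})$. Then $$\rho(\mathcal{L})=\bigcup_{(\alpha,\beta)\in\widetilde{\mathcal{B}}}\sigma\bigl(\mathcal{L}(\alpha,\beta)\bigr)\cap\mathbb{R},$$ where $\widetilde{\mathcal{B}}:=\{-\pi,0,\pi\}\times(\mathbb{R}\setminus\{0\})$.
   Context: The lattice is $\Lambda=\mathbb{Z}$ with unit cell $Y=[0,1]$. The unit cell contains finitely many disjoint closed intervals (resonators) $D_1,\dots,D_N$; the resonators are repeated $1$-periodically along $\mathbb{R}$ and $D$ denotes their union. The coefficients are $1$-periodic, positive and piecewise constant: $\rho(x)=\rho_1>0$ for $x\in D$ and $\rho(x)=\rho_0>0$ for $x\notin D$; $\kappa(x)=\kappa_i>0$ in $D_i$ (and its translates) and $\kappa(x)=\kappa_0>0$ outside $D$. For $\alpha,\beta\in\mathbb{R}$, $\mathcal{L}(\alpha,\beta)$ denotes the restriction of $\mathcal{L}$ to functions with complex quasimomentum $\alpha+\mathrm{i}\beta$, i.e. functions satisfying $u(x+\ell)=e^{\mathrm{i}(\alpha+\mathrm{i}\beta)\ell}u(x)$ for all $\ell\in\mathbb{Z}$,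 and $\mathcal{L}(\alpha):=\mathcal{L}(\alpha,0)$. Its spectrum is discrete: $\lambda=\omega^2\in\mathbb{C}$ belongs to $\sigma(\mathcal{L}(\alpha,\beta))$ iff there is a nonzero $u$ satisfying $\kappa(x)\left(\frac{1}{\rho(x)}u'(x)\right)'+\omega^2u(x)=0$ on each interval where the coefficients are constant, with $u$ and $\frac1\rho u'$ continuous across the boundary points of $D$, and $u(x+\ell)=e^{\mathrm{i}(\alpha+\mathrm{i}\beta)\ell}u(x)$ for all $\ell\in\mathbb{Z}$. *)

(* Defs.v *)
From Stdlib Require Import Reals ZArith.
From Coquelicot Require Import Coquelicot.
Local Open Scope R_scope.

(** The coefficients are functions constrained by their values on and off the
    resonators; since these values determine them at every point, they are
    1-periodic, and the constraints express exactly that the piecewise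
    description is consistent. *)
Record medium := Medium {
  nres : nat;
  lo : nat -> R;          (* resonator i is [lo i, hi i], for i < nres *)
  hi : nat -> R;
  rho0 : R;
  rho1 : R;
  kappa0 : R;
  kappai : nat -> R;
  rho : R -> R;
  kappa : R -> R;

  lo_hi : forall i, (i < nres)%nat -> lo i < hi i;
  in_cell : forall i, (i < nres)%nat -> 0 <= lo i /\ hi i <= 1;
  disjoint : forall i j, (i < nres)%nat -> (j < nres)%nat -> i <> j ->
    forall x, ~ (lo i <= x <= hi i /\ lo j <= x <= hi j);

  rho0_pos : 0 < rho0;
  rho1_pos : 0 < rho1;
  kappa0_pos : 0 < kappa0;
  kappai_pos : forall i, (i < nres)%nat -> 0 < kappai i;

  rho_in : forall i (l : Z) x, (i < nres)%nat ->
    lo i <= x - IZR l <= hi i -> rho x = rho1;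
  kappa_in : forall i (l : Z) x, (i < nres)%nat ->
    lo i <= x - IZR l <= hi i -> kappa x = kappai i;
  rho_out : forall x,
    ~ (exists i (l : Z), (i < nres)%nat /\ lo i <= x - IZR l <= hi i) ->
    rho x = rho0;
  kappa_out : forall x,
    ~ (exists i (l : Z), (i < nres)%nat /\ lo i <= x - IZR l <= hi i) ->
    kappa x = kappa0
}.

Definition resonators (m : medium) (x : R) : Prop :=
  exists i (l : Z), (i < nres m)%nat /\ lo m i <= x - IZR l <= hi m i.

(** Topological boundary: [x] is interior neither to [A] nor to its complement. *)
Definition boundary (A : R -> Prop) (x : R) : Prop :=
  ~ locally x A /\ ~ locally x (fun y => ~ A y).

Definition Cexp (z : C) : C :=
  (exp (Re z) * cos (Im z), exp (Re z) * sin (Im z)).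

Definition quasiperiodic (alpha beta : R) (u : R -> C) : Prop :=
  forall (l : Z) (x : R),
    u (x + IZR l) = (Cexp (Ci * (RtoC alpha + Ci * RtoC beta) * RtoC (IZR l)) * u x)%C.

(** [du] is the derivative of [u] off the boundary of the resonators. Its values
    on this (discrete) boundary play no role: continuity of the flux
    [du / rho] there is the existence of its punctured limit, i.e. the one-sided
    limits exist and agree. *)
Definition solves (m : medium) (lambda : C) (u : R -> C) : Prop :=
  exists du : R -> C,
    let flux := fun y => (RtoC (/ rho m y) * du y)%C in
    (forall x, ~ boundary (resonators m) x ->
       is_derive u x (du x) /\
       exists dflux : C,
         is_derive flux x dflux /\
         (RtoC (kappa m x) * dflux + lambda * u x)%C = RtoC 0) /\
    (forall x, boundary (resonators m) x ->
       continuous u x /\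
       exists f : C, filterlim flux (locally' x) (locally f)).

Definition sigma_at (m : medium) (alpha beta : R) (lambda : C) : Prop :=
  exists u : R -> C,
    (exists x, u x <> RtoC 0) /\ solves m lambda u /\ quasiperiodic alpha beta u.

Definition sigma (m : medium) (lambda : C) : Prop :=
  exists alpha : R, - PI <= alpha <= PI /\ sigma_at m alpha 0 lambda.

Definition resolvent (m : medium) (lambda : R) : Prop := ~ sigma m (RtoC lambda).

Definition Btilde (alpha beta : R) : Prop :=
  (alpha = - PI \/ alpha = 0 \/ alpha = PI) /\ beta <> 0.

(* Main.v *)
(* For real [lambda] the equation is a real first-order system for [u] and the
   flux [p = u' / rho], and the monodromy matrix over one period has determinant 1
   by constancy of the Wronskian. With [D] its trace, [e^{i(alpha + i beta)}] is an
   eigenvalue iff [(e^{-beta} + e^beta) cos alpha = D] and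
   [(e^{-beta} - e^beta) sin alpha = 0]. For [beta = 0] this can be solved for
   [alpha] iff [|D| <= 2]; for [beta <> 0] and [alpha] in [{-pi, 0, pi}] it can be
   solved iff [|D| > 2]. *)
Require Import Defs.
From Stdlib Require Import Reals ZArith Lra Lia Classical IndefiniteDescription.
From Coquelicot Require Import Coquelicot.
Local Open Scope R_scope.

(** * Punctured neighbourhoods *)

(** At a resonator boundary [u'] may jump, so the Wronskian cannot simply be differentiated at every
    point. The working notion is therefore [wsol]: [u] and [p] are continuous, and the equations are
    required only in a punctured neighbourhood of each point. Exceptional points are thereby
    isolated without the resonator endpoints ever being listed or sorted; for the same reason
    solutions on the cell come from a supremum argument instead of a product of transfer matrices.
    Off the boundary the equations are recovered by removability, since the coefficients are locally
    constant there. The two conditions on [alpha] and [beta] are the real and imaginary parts of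
    [mu + 1 / mu = D], the characteristic equation divided by [mu = e^{i(alpha + i beta)}], whose
    modulus is [e^{-beta}]. Quasiperiodicity is imposed on [u] alone; the flux inherits it because a
    solution with [u = 0] has zero flux. *)

Lemma locally_between (a b x : R) : a < x < b -> locally x (fun y => a < y < b).
Proof.
  intros [Ha Hb].
  apply filter_and; [now apply open_gt | now apply open_lt].
Qed.

Lemma locally'_neq (x b : R) : locally' x (fun y => y <> b).
Proof.
  destruct (Req_dec x b) as [<- | Hne].
  - unfold locally', within. now apply filter_forall.
  - apply filter_le_within. apply open_neq. exact Hne.
Qed.

Lemma locally'_of_locally (x : R) (P : R -> Prop) : locally x P -> locally' x P.
Proof. apply filter_le_within. Qed.

Lemma locally_of_locally' (x : R) (P : R -> Prop) :
  P x -> locally' x P -> locally x P.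
Proof.
  intros Hx; unfold locally', within; apply filter_imp; intros y Hy.
  destruct (Req_dec y x) as [-> | Hne]; [exact Hx | now apply Hy].
Qed.

Lemma locally'_sides (x : R) (P : R -> Prop) :
  at_left x P -> at_right x P -> locally' x P.
Proof.
  unfold at_left, at_right, locally', within; intros Hl Hr.
  generalize (filter_and _ _ Hl Hr); apply filter_imp.
  intros y [H1 H2] Hne.
  destruct (Rlt_or_le y x); [now apply H1 | apply H2; lra].
Qed.

Lemma locally'_locally (x : R) (P : R -> Prop) :
  locally' x P -> locally' x (fun y => locally y P).
Proof.
  unfold locally', within; intros H. generalize (locally_locally _ _ H).
  apply filter_imp. intros y Hy Hne.
  generalize (filter_and _ _ Hy (open_neq x y Hne : locally y (fun z => z <> x))).
  apply filter_imp. intros z [H1 H2]. now apply H1.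
Qed.

(* By the mean value theorem the difference quotients at [x] are values of [g]
   near [x]. *)
Lemma is_derive_removable (f g : R -> R) (x : R) :
  (forall y, continuous f y) ->
  locally' x (fun y => is_derive f y (g y)) ->
  continuous g x -> is_derive f x (g x).
Proof.
  intros Hf Hd Hg.
  unfold locally', within in Hd. apply is_derive_Reals. intros eps Heps.
  assert (Hg' : locally x (fun y => Rabs (g y - g x) < eps))
    by exact (proj1 (filterlim_locally g (g x)) Hg (mkposreal _ Heps)).
  destruct (filter_and (F := locally x) _ _ Hd Hg') as [delta Hdelta].
  exists delta. intros h Hh0 Hh.
  (* Differentiability is asked only on the open interval, which avoids [x]; the resulting [c] may
     be [x] itself, so [Hg'] is a full neighbourhood. *)
  destruct (MVT_gen f x (x + h) g) as [c [Hc Heq]].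
  - intros y Hy. apply Hdelta.
    + change (Rabs (y - x) < delta). unfold Rmin, Rmax in Hy.
      destruct (Rle_dec x (x + h)); split_Rabs; lra.
    + unfold Rmin, Rmax in Hy. destruct (Rle_dec x (x + h)); lra.
  - intros y _. apply continuity_pt_filterlim, Hf.
  - rewrite Heq. replace (g c * (x + h - x) / h) with (g c) by (field; exact Hh0).
    apply Hdelta. change (Rabs (c - x) < delta). unfold Rmin, Rmax in Hc.
    destruct (Rle_dec x (x + h)); split_Rabs; lra.
Qed.

(** The zero function is continuous, so removability supplies the derivative at each exceptional
    point and the mean value theorem applies. *)
Lemma constant_of_punctured_derive (f : R -> R) (a b : R) :
  (forall y, continuous f y) ->
  (forall x, locally' x (fun y => a < y < b -> is_derive f y 0)) ->
  forall x, a <= x <= b -> f x = f a.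
Proof.
  intros Hf Hd x Hx.
  destruct (MVT_gen f a x (fun _ => 0)) as [c [_ Hc]].
  - rewrite Rmin_left, Rmax_right by lra. intros y Hy.
    apply (is_derive_removable f (fun _ => 0)); [exact Hf | | apply continuous_const].
    generalize (filter_and _ _ (Hd y) (locally'_of_locally _ _ (locally_between a x y Hy))).
    apply filter_imp. intros z [H1 H2]. apply H1; lra.
  - intros y _. apply continuity_pt_filterlim, Hf.
  - lra.
Qed.

(** * Translation, linear combination and gluing of real functions *)

Lemma locally_shift (x t : R) (P : R -> Prop) :
  locally (x + t) P -> locally x (fun y => P (y + t)).
Proof.
  intros [d Hd]. exists d. intros y Hy. apply Hd.
  change (Rabs (y - x) < d) in Hy. change (Rabs (y + t - (x + t)) < d).
  now replace (y + t - (x + t)) with (y - x) by ring.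
Qed.

Lemma locally'_shift (x t : R) (P : R -> Prop) :
  locally' (x + t) P -> locally' x (fun y => P (y + t)).
Proof.
  unfold locally', within; intros H. generalize (locally_shift _ _ _ H). apply filter_imp.
  intros y Hy Hne. apply Hy. lra.
Qed.

Lemma is_derive_shift (f : R -> R) (x t l : R) :
  is_derive f (x + t) l -> is_derive (fun y => f (y + t)) x l.
Proof.
  intros H. replace l with (scal 1 l) by (apply Rmult_1_l).
  apply (is_derive_comp f (fun y => y + t)); [exact H | auto_derive; [exact I | ring]].
Qed.

Lemma continuous_shift (f : R -> R) (x t : R) :
  continuous f (x + t) -> continuous (fun y => f (y + t)) x.
Proof.
  intros H. apply (continuous_comp (fun y => y + t) f); [| exact H].
  apply (continuous_plus (fun y => y) (fun _ => t));
    [apply continuous_id | apply continuous_const].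
Qed.

Lemma continuous_lincomb (f g : R -> R) (a b x : R) :
  continuous f x -> continuous g x -> continuous (fun y => a * f y + b * g y) x.
Proof.
  intros Hf Hg.
  apply (continuous_plus (fun y => a * f y) (fun y => b * g y));
    [apply (continuous_scal_r a f) | apply (continuous_scal_r b g)]; assumption.
Qed.

Lemma is_derive_lincomb (f g : R -> R) (a b x f' g' : R) :
  is_derive f x f' -> is_derive g x g' ->
  is_derive (fun y => a * f y + b * g y) x (a * f' + b * g').
Proof.
  intros Hf Hg.
  apply (is_derive_plus (fun y => a * f y) (fun y => b * g y));
    [apply (is_derive_scal f) | apply (is_derive_scal g)]; assumption.
Qed.

Lemma continuous_glue (f g : R -> R) (b : R) :
  f b = g b -> (forall x, continuous f x) -> (forall x, continuous g x) ->
  forall x, continuous (fun y => if Rle_dec y b then f y else g y) x.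
Proof.
  intros Hb Hf Hg x.
  apply filterlim_locally. intros eps.
  assert (Hfx := proj1 (filterlim_locally f (f x)) (Hf x) eps).
  assert (Hgx := proj1 (filterlim_locally g (g x)) (Hg x) eps).
  destruct (Rtotal_order x b) as [Hx | [-> | Hx]].
  - generalize (filter_and _ _ Hfx (open_lt b x Hx : locally x (fun z => z < b))). apply filter_imp.
    intros y [H1 H2]. destruct (Rle_dec y b); [| lra]. destruct (Rle_dec x b); [exact H1 | lra].
  - generalize (filter_and _ _ Hfx Hgx). apply filter_imp.
    intros y [H1 H2]. destruct (Rle_dec b b); [| lra].
    destruct (Rle_dec y b); [exact H1 | rewrite Hb; exact H2].
  - generalize (filter_and _ _ Hgx (open_gt b x Hx : locally x (fun z => z > b))). apply filter_imp.
    intros y [H1 H2]. destruct (Rle_dec y b); [lra |]. destruct (Rle_dec x b); [lra | exact H1].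
Qed.

(** * Weak solutions and the Wronskian *)

(* Weak solutions on [I] of the first-order system for [u] and the flux [p];
   isolated exceptional points are allowed, and [u], [p] are continuous
   everywhere. *)
Definition ode (m : medium) (lam : R) (u p : R -> R) (y : R) : Prop :=
  is_derive u y (rho m y * p y) /\ is_derive p y (- (lam / kappa m y) * u y).

Definition wsol (m : medium) (lam : R) (I : R -> Prop) (u p : R -> R) : Prop :=
  (forall x, continuous u x) /\ (forall x, continuous p x) /\
  forall x, locally' x (fun y => I y -> ode m lam u p y).

Lemma ode_ext (m : medium) (lam : R) (u p v q : R -> R) (y : R) :
  locally y (fun z => u z = v z) -> locally y (fun z => p z = q z) ->
  ode m lam u p y -> ode m lam v q y.
Proof.
  intros Hu Hp [H1 H2].
  rewrite (locally_singleton _ _ Hp) in H1. rewrite (locally_singleton _ _ Hu) in H2.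
  split; [now apply (is_derive_ext_loc u) | now apply (is_derive_ext_loc p)].
Qed.

Lemma ode_lincomb (m : medium) (lam : R) (u p v q : R -> R) (a b y : R) :
  ode m lam u p y -> ode m lam v q y ->
  ode m lam (fun y => a * u y + b * v y) (fun y => a * p y + b * q y) y.
Proof.
  intros [H1 H2] [H3 H4]. split.
  - replace (rho m y * (a * p y + b * q y))
      with (a * (rho m y * p y) + b * (rho m y * q y)) by ring.
    now apply is_derive_lincomb.
  - replace (- (lam / kappa m y) * (a * u y + b * v y))
      with (a * (- (lam / kappa m y) * u y) + b * (- (lam / kappa m y) * v y)) by ring.
    now apply is_derive_lincomb.
Qed.

Lemma wsol_lincomb (m : medium) (lam : R) (I : R -> Prop) (u p v q : R -> R) (a b : R) :
  wsol m lam I u p -> wsol m lam I v q ->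
  wsol m lam I (fun y => a * u y + b * v y) (fun y => a * p y + b * q y).
Proof.
  intros (Hu & Hp & H1) (Hv & Hq & H2). repeat split.
  - intros x. now apply continuous_lincomb.
  - intros x. now apply continuous_lincomb.
  - intros x. generalize (filter_and _ _ (H1 x) (H2 x)). apply filter_imp.
    intros y [H3 H4] Hy. apply ode_lincomb; auto.
Qed.

Lemma wsol_subset (m : medium) (lam : R) (I J : R -> Prop) (u p : R -> R) :
  (forall x, J x -> I x) -> wsol m lam I u p -> wsol m lam J u p.
Proof.
  intros HIJ (Hu & Hp & H). repeat split; auto.
  intros x. generalize (H x). apply filter_imp. auto.
Qed.

(** In the derivative of [u q - v p] the two [rho] terms cancel, and so do the two [lam / kappa]
    terms. Continuity extends the identity to both endpoints. *)
Lemma wronskian_constant (m : medium) (lam a b : R) (u p v q : R -> R) :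
  wsol m lam (fun y => a < y < b) u p -> wsol m lam (fun y => a < y < b) v q ->
  forall x, a <= x <= b -> u x * q x - v x * p x = u a * q a - v a * p a.
Proof.
  intros (Hu & Hp & H1) (Hv & Hq & H2).
  apply (constant_of_punctured_derive (fun x => u x * q x - v x * p x)).
  - intros y.
    apply (continuous_minus (fun x => u x * q x) (fun x => v x * p x)).
    + apply (continuous_mult u q); auto.
    + apply (continuous_mult v p); auto.
  - intros x. generalize (filter_and _ _ (H1 x) (H2 x)). apply filter_imp.
    intros y [H3 H4] Hy. destruct (H3 Hy) as [Du Dp]. destruct (H4 Hy) as [Dv Dq].
    replace 0 with (minus
      (plus (mult (rho m y * p y) (q y)) (mult (u y) (- (lam / kappa m y) * v y)))
      (plus (mult (rho m y * q y) (p y)) (mult (v y) (- (lam / kappa m y) * u y)))).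
    + apply (is_derive_minus (fun x => u x * q x) (fun x => v x * p x)).
      * apply (is_derive_mult u q); [assumption.. | exact Rmult_comm].
      * apply (is_derive_mult v p); [assumption.. | exact Rmult_comm].
    + unfold minus, plus, opp, mult; simpl. ring.
Qed.

(** The pairs [(c, P)] and [(s, Q)] are the columns of the propagator from 0; their values at 1 form
    the monodromy matrix, with trace [c 1 + Q 1]. *)
Definition fundamental (m : medium) (lam : R) (c P s Q : R -> R) : Prop :=
  wsol m lam (fun y => 0 < y < 1) c P /\ wsol m lam (fun y => 0 < y < 1) s Q /\
  c 0 = 1 /\ P 0 = 0 /\ s 0 = 0 /\ Q 0 = 1.

Lemma fundamental_det (m : medium) (lam : R) (c P s Q : R -> R) :
  fundamental m lam c P s Q ->
  forall x, 0 <= x <= 1 -> c x * Q x - s x * P x = 1.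
Proof.
  intros (H1 & H2 & c0 & P0 & s0 & Q0) x Hx.
  rewrite (wronskian_constant m lam 0 1 c P s Q H1 H2 x Hx), c0, P0, s0, Q0. ring.
Qed.

(** Cramer's rule: the Wronskians of [(u, p)] with the two columns keep their initial values [- p 0]
    and [u 0], and the columns have determinant 1. This doubles as uniqueness for the initial value
    problem. *)
Lemma fundamental_span (m : medium) (lam : R) (c P s Q u p : R -> R) :
  fundamental m lam c P s Q -> wsol m lam (fun y => 0 < y < 1) u p ->
  forall x, 0 <= x <= 1 ->
    u x = u 0 * c x + p 0 * s x /\ p x = u 0 * P x + p 0 * Q x.
Proof.
  intros HF Hu x Hx. assert (Hdet := fundamental_det _ _ _ _ _ _ HF x Hx).
  destruct HF as (H1 & H2 & c0 & P0 & s0 & Q0).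
  assert (W1 := wronskian_constant _ _ _ _ _ _ _ _ Hu H1 x Hx).
  assert (W2 := wronskian_constant _ _ _ _ _ _ _ _ Hu H2 x Hx).
  rewrite c0, P0 in W1. rewrite s0, Q0 in W2.
  split.
  - transitivity (u x * (c x * Q x - s x * P x)); [rewrite Hdet; ring |].
    transitivity (c x * (u x * Q x - s x * p x) - s x * (u x * P x - c x * p x)); [ring |].
    rewrite W1, W2. ring.
  - transitivity (p x * (c x * Q x - s x * P x)); [rewrite Hdet; ring |].
    transitivity (P x * (u x * Q x - s x * p x) - Q x * (u x * P x - c x * p x)); [ring |].
    rewrite W1, W2. ring.
Qed.

(** * The coefficients near a point *)

Local Ltac filter_lra := apply filter_imp; intros; cbv beta in *; lra.

Lemma rho_pos (m : medium) (x : R) : 0 < rho m x.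
Proof.
  destruct (classic (resonators m x)) as [(i & l & Hi & Hx) | Hx].
  - rewrite (rho_in m i l x Hi Hx). apply rho1_pos.
  - rewrite (rho_out m x Hx). apply rho0_pos.
Qed.

Lemma kappa_pos (m : medium) (x : R) : 0 < kappa m x.
Proof.
  destruct (classic (resonators m x)) as [(i & l & Hi & Hx) | Hx].
  - rewrite (kappa_in m i l x Hi Hx). now apply kappai_pos.
  - rewrite (kappa_out m x Hx). apply kappa0_pos.
Qed.

Lemma coefficients_periodic (m : medium) (x : R) (n : Z) :
  rho m (x + IZR n) = rho m x /\ kappa m (x + IZR n) = kappa m x.
Proof.
  destruct (classic (resonators m x)) as [(i & l & Hi & Hx) | Hx].
  - assert (Hn : lo m i <= x + IZR n - IZR (l + n) <= hi m i) by (rewrite plus_IZR; lra).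
    now rewrite (rho_in m i l x), (rho_in m i _ _ Hi Hn),
      (kappa_in m i l x), (kappa_in m i _ _ Hi Hn).
  - assert (Hn : ~ resonators m (x + IZR n)).
    { intros (i & l & Hi & Hy). apply Hx. exists i, (l - n)%Z. rewrite minus_IZR.
      split; [exact Hi | lra]. }
    now rewrite (rho_out m x Hx), (rho_out m _ Hn), (kappa_out m x Hx), (kappa_out m _ Hn).
Qed.

(** The filter is abstract so that one induction over the resonators serves left and right
    neighbourhoods. Finitely many decisions settle membership, and the strict inequalities of the
    open cell exclude every translate other than the one by [n]. *)
Lemma resonator_germ (m : medium) (F : (R -> Prop) -> Prop) {FF : Filter F} (n : Z) :
  F (fun y => IZR n < y < IZR n + 1) ->
  (forall a b, a < b -> F (fun y => a <= y - IZR n <= b) \/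
                        F (fun y => ~ (a <= y - IZR n <= b))) ->
  (exists i, (i < nres m)%nat /\ F (fun y => lo m i <= y - IZR n <= hi m i)) \/
  F (fun y => ~ resonators m y).
Proof.
  intros Hn Hdec.
  assert (H : forall k, (k <= nres m)%nat ->
    (exists i, (i < nres m)%nat /\ F (fun y => lo m i <= y - IZR n <= hi m i)) \/
    F (fun y => forall i, (i < k)%nat -> ~ (lo m i <= y - IZR n <= hi m i))).
  { induction k as [| k IH]; intros Hk.
    - right. apply filter_forall. intros y i Hi. lia.
    - destruct IH as [IH | IH]; [lia | now left |].
      destruct (Hdec (lo m k) (hi m k)) as [H | H]; [now apply lo_hi | |].
      + left. now exists k.
      + right. generalize (filter_and _ _ IH H). apply filter_imp.
        intros y [H1 H2] i Hi.
        destruct (Nat.eq_dec i k) as [-> | Hik]; [exact H2 | apply H1; lia]. }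
  destruct (H (nres m) (le_n _)) as [H' | H']; [now left | right].
  generalize (filter_and _ _ Hn H'). apply filter_imp.
  intros y [H1 H2] (i & l & Hi & Hy).
  destruct (in_cell m i Hi).
  assert (l = n) as ->; [| now apply (H2 i)].
  assert (n < l + 1)%Z by (apply lt_IZR; rewrite plus_IZR; lra).
  assert (l < n + 1)%Z by (apply lt_IZR; rewrite plus_IZR; lra).
  lia.
Qed.

Lemma at_right_between (x b : R) : x < b -> at_right x (fun y => x < y < b).
Proof.
  intros Hb. unfold at_right, within.
  generalize (open_lt b x Hb : locally x (fun z => z < b)). filter_lra.
Qed.

Lemma at_left_between (x a : R) : a < x -> at_left x (fun y => a < y < x).
Proof.
  intros Ha. unfold at_left, within.
  generalize (open_gt a x Ha : locally x (fun z => z > a)). filter_lra.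
Qed.

(** That [x] itself belongs to the resonator follows from closedness; this clause later ties
    one-sided coefficient values to the value at [x]. *)
Lemma resonator_germ_right (m : medium) (x : R) :
  (exists i n, (i < nres m)%nat /\ lo m i <= x - IZR n <= hi m i /\
     at_right x (fun y => lo m i <= y - IZR n <= hi m i)) \/
  at_right x (fun y => ~ resonators m y).
Proof.
  assert (Hx := base_Int_part x). set (n := Int_part x) in *.
  destruct (resonator_germ m (at_right x) n) as [(i & Hi & H) | H].
  - generalize (at_right_between x (IZR n + 1) ltac:(lra)). filter_lra.
  - intros a b Hab. destruct (Rlt_or_le (x - IZR n) a) as [H1 | H1].
    + right. generalize (at_right_between x (a + IZR n) ltac:(lra)). filter_lra.
    + destruct (Rlt_or_le (x - IZR n) b) as [H2 | H2].
      * left. generalize (at_right_between x (b + IZR n) ltac:(lra)). filter_lra.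
      * right. generalize (at_right_between x (x + 1) ltac:(lra)). filter_lra.
  - left. exists i, n. split; [exact Hi |]. split; [| exact H].
    destruct (Rlt_or_le (x - IZR n) (lo m i)) as [H1 | H1];
      [| destruct (Rlt_or_le (hi m i) (x - IZR n)) as [H2 | H2]; [| lra]].
    + destruct (filter_ex (F := at_right x) _ (filter_and _ _ H
        (at_right_between x (lo m i + IZR n) ltac:(lra)))) as [y Hy]. lra.
    + destruct (filter_ex (F := at_right x) _ (filter_and _ _ H
        (at_right_between x (x + 1) ltac:(lra)))) as [y Hy]. lra.
  - now right.
Qed.

Lemma resonator_germ_left (m : medium) (x : R) :
  (exists i n, (i < nres m)%nat /\ lo m i <= x - IZR n <= hi m i /\
     at_left x (fun y => lo m i <= y - IZR n <= hi m i)) \/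
  at_left x (fun y => ~ resonators m y).
Proof.
  assert (exists n, IZR n < x <= IZR n + 1) as [n Hx].
  (* The ceiling of [x] minus one: the left neighbourhood of an integer lies in the preceding
     cell. *)
  { exists (- Int_part (- x) - 1)%Z. destruct (base_Int_part (- x)).
    rewrite minus_IZR, opp_IZR. lra. }
  destruct (resonator_germ m (at_left x) n) as [(i & Hi & H) | H].
  - generalize (at_left_between x (IZR n) ltac:(lra)). filter_lra.
  - intros a b Hab. destruct (Rlt_or_le b (x - IZR n)) as [H1 | H1].
    + right. generalize (at_left_between x (b + IZR n) ltac:(lra)). filter_lra.
    + destruct (Rlt_or_le a (x - IZR n)) as [H2 | H2].
      * left. generalize (at_left_between x (a + IZR n) ltac:(lra)). filter_lra.
      * right. generalize (at_left_between x (x - 1) ltac:(lra)). filter_lra.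
  - left. exists i, n. split; [exact Hi |]. split; [| exact H].
    destruct (Rlt_or_le (hi m i) (x - IZR n)) as [H1 | H1];
      [| destruct (Rlt_or_le (x - IZR n) (lo m i)) as [H2 | H2]; [| lra]].
    + destruct (filter_ex (F := at_left x) _ (filter_and _ _ H
        (at_left_between x (hi m i + IZR n) ltac:(lra)))) as [y Hy]. lra.
    + destruct (filter_ex (F := at_left x) _ (filter_and _ _ H
        (at_left_between x (x - 1) ltac:(lra)))) as [y Hy]. lra.
  - now right.
Qed.

Lemma coefficients_germ (m : medium) (F : (R -> Prop) -> Prop) {FF : Filter F} (x : R) :
  (exists i n, (i < nres m)%nat /\ lo m i <= x - IZR n <= hi m i /\
     F (fun y => lo m i <= y - IZR n <= hi m i)) \/ F (fun y => ~ resonators m y) ->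
  exists r k, F (fun y => rho m y = r /\ kappa m y = k).
Proof.
  intros [(i & n & Hi & _ & H) | H].
  - exists (rho1 m), (kappai m i).
    revert H. apply filter_imp. intros y Hy. split.
    + now apply (rho_in m i n).
    + now apply (kappa_in m i n).
  - exists (rho0 m), (kappa0 m).
    revert H. apply filter_imp. intros y Hy. split.
    + now apply rho_out.
    + now apply kappa_out.
Qed.

Lemma at_left_locally (x : R) (P : R -> Prop) :
  at_left x P -> at_left x (fun y => locally y P).
Proof.
  intros HP. unfold at_left, within in *. generalize (locally_locally _ _ HP).
  apply filter_imp. intros y Hy Hyx.
  generalize (filter_and _ _ Hy (open_lt x y Hyx : locally y (fun z => z < x))).
  apply filter_imp. intros z [H1 H2]. now apply H1.
Qed.

Lemma at_right_locally (x : R) (P : R -> Prop) :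
  at_right x P -> at_right x (fun y => locally y P).
Proof.
  intros HP. unfold at_right, within in *. generalize (locally_locally _ _ HP).
  apply filter_imp. intros y Hy Hyx.
  generalize (filter_and _ _ Hy (open_gt x y Hyx : locally y (fun z => z > x))).
  apply filter_imp. intros z [H1 H2]. now apply H1.
Qed.

(** On each side of [x] the germ lies in one resonator or in the complement, and an open one-sided
    interval is a neighbourhood of each of its points. Hence boundary points are isolated. *)
Lemma locally'_not_boundary (m : medium) (x : R) :
  locally' x (fun y => ~ boundary (resonators m) y).
Proof.
  apply locally'_sides.
  - destruct (resonator_germ_left m x) as [(i & n & Hi & _ & H) | H];
      generalize (at_left_locally _ _ H); apply filter_imp; intros y Hy [B1 B2].
    + apply B1. revert Hy. apply filter_imp. intros z Hz. now exists i, n.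
    + contradiction.
  - destruct (resonator_germ_right m x) as [(i & n & Hi & _ & H) | H];
      generalize (at_right_locally _ _ H); apply filter_imp; intros y Hy [B1 B2].
    + apply B1. revert Hy. apply filter_imp. intros z Hz. now exists i, n.
    + contradiction.
Qed.

(** Inside [resonators] two translates from adjacent cells may touch at an integer [x]. Both are
    closed and contain [x], so the coefficients on either side equal those at [x]. *)
Lemma coefficients_locally_constant (m : medium) (x : R) :
  ~ boundary (resonators m) x ->
  locally x (fun y => rho m y = rho m x /\ kappa m y = kappa m x).
Proof.
  intros Hx.
  assert (locally x (resonators m) \/ locally x (fun y => ~ resonators m y)) as [H | H].
  { unfold boundary in Hx. tauto. }
  - apply locally_of_locally'; [now split |].
    assert (Hconst : forall i n, (i < nres m)%nat -> lo m i <= x - IZR n <= hi m i ->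
      forall y, lo m i <= y - IZR n <= hi m i -> rho m y = rho m x /\ kappa m y = kappa m x).
    { intros i n Hi Hxi y Hy.
      now rewrite (rho_in m i n x), (rho_in m i n y), (kappa_in m i n x), (kappa_in m i n y). }
    apply locally'_sides.
    + destruct (resonator_germ_left m x) as [(i & n & Hi & Hxi & Hg) | Hg].
      * revert Hg. apply filter_imp. now apply Hconst.
      * destruct (filter_ex (F := at_left x) _ (filter_and _ _ Hg
          (filter_le_within _ _ H))) as [y [H1 H2]]. contradiction.
    + destruct (resonator_germ_right m x) as [(i & n & Hi & Hxi & Hg) | Hg].
      * revert Hg. apply filter_imp. now apply Hconst.
      * destruct (filter_ex (F := at_right x) _ (filter_and _ _ Hg
          (filter_le_within _ _ H))) as [y [H1 H2]]. contradiction.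
  - assert (H0 := locally_singleton _ _ H).
    revert H. apply filter_imp. intros y Hy.
    now rewrite (rho_out m x), (rho_out m y), (kappa_out m x), (kappa_out m y).
Qed.

(** * Solutions on the unit cell *)

(** Generalised cosine and sine for [f'' = - K f], scaled so that [s' = c]. All signs of [K] occur
    because [lam] is an arbitrary real. *)
Lemma harmonic_oscillator (K : R) :
  exists c s : R -> R, c 0 = 1 /\ s 0 = 0 /\
    forall x, is_derive c x (- K * s x) /\ is_derive s x (c x).
Proof.
  destruct (Rtotal_order K 0) as [HK | [-> | HK]].
  - assert (Hw : 0 < sqrt (- K)) by (apply sqrt_lt_R0; lra).
    assert (Hw2 : sqrt (- K) * sqrt (- K) = - K) by (apply sqrt_sqrt; lra).
    set (w := sqrt (- K)) in *. rewrite <- Hw2.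
    exists (fun x => cosh (w * x)), (fun x => sinh (w * x) / w).
    rewrite Rmult_0_r, cosh_0, sinh_0. split; [reflexivity |]. split; [field; lra |].
    intros x. unfold cosh, sinh. split; auto_derive; trivial; field; lra.
  - exists (fun _ => 1), (fun x => x). split; [reflexivity |]. split; [reflexivity |].
    intros x. split; auto_derive; trivial; ring.
  - assert (Hw : 0 < sqrt K) by (apply sqrt_lt_R0; lra).
    assert (Hw2 : sqrt K * sqrt K = K) by (apply sqrt_sqrt; lra).
    set (w := sqrt K) in *. rewrite <- Hw2.
    exists (fun x => cos (w * x)), (fun x => sin (w * x) / w).
    rewrite Rmult_0_r, cos_0, sin_0. split; [reflexivity |]. split; [field; lra |].
    intros x. split; auto_derive; trivial; field; lra.
Qed.

Definition solvable (m : medium) (lam a b : R) : Prop :=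
  forall u0 p0, exists u p,
    wsol m lam (fun y => a < y < b) u p /\ u a = u0 /\ p a = p0.

Lemma solvable_constant (m : medium) (lam a b r k : R) :
  (forall y, a < y < b -> rho m y = r /\ kappa m y = k) -> solvable m lam a b.
Proof.
  intros Hrk u0 p0. set (q := lam / k).
  destruct (harmonic_oscillator (r * q)) as (c & s & c0 & s0 & D).
  assert (Hc : forall x, is_derive (fun y => c (y + - a)) x (- (r * q) * s (x + - a)))
    by (intros x; apply is_derive_shift, D).
  assert (Hs : forall x, is_derive (fun y => s (y + - a)) x (c (x + - a)))
    by (intros x; apply is_derive_shift, D).
  assert (Cc : forall x, continuous (fun y => c (y + - a)) x)
    by (intros x; apply (ex_derive_continuous (fun y => c (y + - a))); eexists; apply Hc).
  assert (Cs : forall x, continuous (fun y => s (y + - a)) x)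
    by (intros x; apply (ex_derive_continuous (fun y => s (y + - a))); eexists; apply Hs).
  (* Both components satisfy [f'' = - (r q) f]; the coefficients of [s] are the initial slopes
     [u' = r p0] and [p' = - q u0]. *)
  exists (fun y => u0 * c (y + - a) + r * p0 * s (y + - a)).
  exists (fun y => p0 * c (y + - a) + - (q * u0) * s (y + - a)).
  repeat split.
  - intros x. now apply (continuous_lincomb (fun y => c (y + - a)) (fun y => s (y + - a))).
  - intros x. now apply (continuous_lincomb (fun y => c (y + - a)) (fun y => s (y + - a))).
  - intros x. apply filter_forall. intros y Hy.
    destruct (Hrk y Hy) as [Hr Hk]. unfold ode. rewrite Hr, Hk. fold q. split.
    + replace (r * (p0 * c (y + - a) + - (q * u0) * s (y + - a))) with
        (u0 * (- (r * q) * s (y + - a)) + r * p0 * c (y + - a)) by ring.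
      now apply (is_derive_lincomb (fun y => c (y + - a)) (fun y => s (y + - a))).
    + replace (- q * (u0 * c (y + - a) + r * p0 * s (y + - a))) with
        (p0 * (- (r * q) * s (y + - a)) + - (q * u0) * c (y + - a)) by ring.
      now apply (is_derive_lincomb (fun y => c (y + - a)) (fun y => s (y + - a))).
  - rewrite Rplus_opp_r, c0, s0. ring.
  - rewrite Rplus_opp_r, c0, s0. ring.
Qed.

(** The second piece starts from the values reached by the first, which gives continuity; [b] merely
    becomes one more exceptional point. *)
Lemma solvable_glue (m : medium) (lam a b c : R) :
  a <= b -> b <= c -> solvable m lam a b -> solvable m lam b c -> solvable m lam a c.
Proof.
  intros Hab Hbc H1 H2 u0 p0.
  destruct (H1 u0 p0) as (u & p & (Cu & Cp & D1) & ua & pa).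
  destruct (H2 (u b) (p b)) as (v & q & (Cv & Cq & D2) & vb & qb).
  exists (fun y => if Rle_dec y b then u y else v y).
  exists (fun y => if Rle_dec y b then p y else q y).
  split; [split; [| split] |].
  - now apply continuous_glue.
  - now apply continuous_glue.
  - intros x.
    generalize (filter_and _ _ (locally'_neq x b) (filter_and _ _ (D1 x) (D2 x))).
    apply filter_imp. intros y (Hy & E1 & E2) Hac.
    destruct (Rdichotomy y b Hy) as [Hlt | Hgt].
    + apply (ode_ext m lam u p); [| | apply E1; lra];
        generalize (open_lt b y Hlt : locally y (fun z => z < b)); apply filter_imp;
        intros z Hz; destruct (Rle_dec z b); lra.
    + apply (ode_ext m lam v q); [| | apply E2; lra];
        generalize (open_gt b y Hgt : locally y (fun z => z > b)); apply filter_imp;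
        intros z Hz; destruct (Rle_dec z b); lra.
  - destruct (Rle_dec a b); [now split | lra].
Qed.

Lemma coefficients_constant_right (m : medium) (x : R) :
  exists b r k, x < b /\ forall y, x < y < b -> rho m y = r /\ kappa m y = k.
Proof.
  destruct (coefficients_germ m (at_right x) x (resonator_germ_right m x))
    as (r & k & [d Hd]).
  exists (x + d), r, k. assert (Hd0 := cond_pos d). split; [lra |].
  intros y Hy. apply Hd; [| lra]. change (Rabs (y - x) < d). split_Rabs; lra.
Qed.

Lemma coefficients_constant_left (m : medium) (x : R) :
  exists a r k, a < x /\ forall y, a < y < x -> rho m y = r /\ kappa m y = k.
Proof.
  destruct (coefficients_germ m (at_left x) x (resonator_germ_left m x))
    as (r & k & [d Hd]).
  exists (x - d), r, k. assert (Hd0 := cond_pos d). split; [lra |].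
  intros y Hy. apply Hd; [| lra]. change (Rabs (y - x) < d). split_Rabs; lra.
Qed.

(* The supremum [s] of the solvable endpoints is itself one, because the
   coefficients are constant just left of [s], and it is not below 1, because
   they are constant just right of [s]. *)
Lemma solvable_cell (m : medium) (lam : R) : solvable m lam 0 1.
Proof.
  set (E := fun b => 0 <= b <= 1 /\ solvable m lam 0 b).
  assert (HE0 : E 0).
  (* The interval is empty, so the coefficient values [r = k = 0] are placeholders. *)
  { split; [lra |]. apply (solvable_constant m lam 0 0 0 0). intros y Hy. lra. }
  destruct (completeness E) as [s [Hub Hlub]].
  - exists 1. intros b [Hb _]. lra.
  - now exists 0.
  - assert (0 <= s) by now apply Hub.
    assert (s <= 1) by (apply Hlub; intros b [Hb _]; lra).
    assert (Hs : solvable m lam 0 s).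
    { destruct (coefficients_constant_left m s) as (a & r & k & Ha & Hrk).
      (* Some solvable endpoint exceeds [a], for otherwise [a < s] would be an upper bound of
         [E]. *)
      destruct (classic (exists b, E b /\ a < b)) as [(b & Hb & Hab) | Hno].
      - assert (b <= s) by now apply Hub.
        destruct Hb as [Hb Sb]. apply (solvable_glue m lam 0 b s); [lra | lra | exact Sb |].
        apply (solvable_constant m lam b s r k). intros y Hy. apply Hrk. lra.
      - assert (s <= a); [| lra]. apply Hlub. intros b Hb.
        destruct (Rle_or_lt b a); [assumption |]. exfalso. apply Hno. now exists b. }
    destruct (Rle_lt_or_eq_dec s 1) as [Hs1 | <-]; [assumption | | exact Hs].
    destruct (coefficients_constant_right m s) as (c & r & k & Hc & Hrk).
    assert (s < Rmin c 1) by (apply Rmin_glb_lt; lra).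
    assert (Hm1 := Rmin_l c 1). assert (Hm2 := Rmin_r c 1).
    assert (Rmin c 1 <= s); [| lra]. apply Hub. split; [lra |].
    apply (solvable_glue m lam 0 s); [lra | lra | exact Hs |].
    apply (solvable_constant m lam _ _ r k). intros y Hy. apply Hrk. lra.
Qed.

Lemma fundamental_exists (m : medium) (lam : R) :
  exists c P s Q, fundamental m lam c P s Q.
Proof.
  destruct (solvable_cell m lam 1 0) as (c & P & H1 & c0 & P0).
  destruct (solvable_cell m lam 0 1) as (s & Q & H2 & s0 & Q0).
  exists c, P, s, Q. repeat split; auto; try apply H1; apply H2.
Qed.

(** * Solutions on the line *)

Lemma wsol_shift (m : medium) (lam : R) (I : R -> Prop) (u p : R -> R) (n : Z) :
  wsol m lam I u p ->
  wsol m lam (fun y => I (y + IZR n)) (fun y => u (y + IZR n)) (fun y => p (y + IZR n)).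
Proof.
  intros (Cu & Cp & D). repeat split.
  - intros x. now apply continuous_shift.
  - intros x. now apply continuous_shift.
  - intros x. generalize (locally'_shift _ _ _ (D (x + IZR n))). apply filter_imp.
    intros y H Hy. destruct (H Hy) as [H1 H2].
    destruct (coefficients_periodic m y n) as [Hr Hk]. rewrite Hr in H1. rewrite Hk in H2.
    split; now apply is_derive_shift.
Qed.

(** Locally constant coefficients make both right-hand sides continuous at [x], so the derivatives
    there are removable. *)
Lemma wsol_ode (m : medium) (lam : R) (u p : R -> R) (x : R) :
  wsol m lam (fun _ => True) u p -> ~ boundary (resonators m) x -> ode m lam u p x.
Proof.
  intros (Cu & Cp & D) Hx. assert (Hc := coefficients_locally_constant m x Hx). split.
  - apply (is_derive_removable u (fun y => rho m y * p y)); [exact Cu | |].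
    + generalize (D x). apply filter_imp. intros y Hy. now apply Hy.
    + apply (continuous_ext_loc _ (fun y => rho m x * p y)).
      * revert Hc. apply filter_imp. now intros y [-> _].
      * apply (continuous_scal_r (rho m x) p), Cp.
  - apply (is_derive_removable p (fun y => - (lam / kappa m y) * u y)); [exact Cp | |].
    + generalize (D x). apply filter_imp. intros y Hy. now apply Hy.
    + apply (continuous_ext_loc _ (fun y => - (lam / kappa m x) * u y)).
      * revert Hc. apply filter_imp. now intros y [_ ->].
      * apply (continuous_scal_r (- (lam / kappa m x)) u), Cu.
Qed.

(** Points where [rho p = u' = 0] accumulate at [x], and [p] is continuous. By linearity, [u]
    determines its flux. *)
Lemma wsol_flux_zero (m : medium) (lam : R) (u p : R -> R) :
  wsol m lam (fun _ => True) u p -> (forall x, u x = 0) -> forall x, p x = 0.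
Proof.
  intros (Cu & Cp & D) Hu x. apply NNPP. intros Hpx.
  assert (Hne : locally x (fun y => p y <> 0)) by exact (Cp x _ (open_neq 0 (p x) Hpx)).
  generalize (filter_and _ _ (D x) (locally'_of_locally _ _ Hne)). intros H.
  assert (H' : at_right x (fun y => ode m lam u p y /\ p y <> 0)).
  { unfold locally', at_right, within in *. revert H. apply filter_imp.
    intros y Hy Hxy. destruct Hy as [H1 H2]; [lra | now split; [apply H1 |]]. }
  destruct (filter_ex (F := at_right x) _ H') as (y & [Du _] & Hp).
  apply Hp. apply (Rmult_eq_reg_l (rho m y)); [| generalize (rho_pos m y); lra].
  rewrite Rmult_0_r, <- (is_derive_unique _ _ _ Du), (Derive_ext _ (fun _ => 0) _ Hu).
  apply Derive_const.
Qed.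

Lemma Int_part_unique (x : R) (n : Z) : IZR n <= x < IZR n + 1 -> Int_part x = n.
Proof. intros H. symmetry. apply Int_part_spec. lra. Qed.

Lemma Int_part_add (x : R) (n : Z) : Int_part (x + IZR n) = (Int_part x + n)%Z.
Proof.
  apply Int_part_unique. rewrite plus_IZR. generalize (base_Int_part x). lra.
Qed.

(** Concatenates cell solutions: with [c], [s] it gives [u], with [P], [Q] its flux, and
    [(a n, b n)] are the Cauchy data at the integer [n]. *)
Definition cellwise (a b : Z -> R) (f g : R -> R) (x : R) : R :=
  let n := Int_part x in a n * f (x + IZR (- n)) + b n * g (x + IZR (- n)).

Lemma cellwise_eq (a b : Z -> R) (f g : R -> R) (x : R) (n : Z) :
  IZR n <= x < IZR n + 1 ->
  cellwise a b f g x = a n * f (x + IZR (- n)) + b n * g (x + IZR (- n)).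
Proof. intros H. unfold cellwise. now rewrite (Int_part_unique x n H). Qed.

Lemma cellwise_continuous (a b : Z -> R) (f g : R -> R) :
  (forall x, continuous f x) -> (forall x, continuous g x) ->
  (forall n, a n * f 1 + b n * g 1 = a (n + 1)%Z * f 0 + b (n + 1)%Z * g 0) ->
  forall x, continuous (cellwise a b f g) x.
Proof.
  intros Cf Cg Hm x.
  set (F := fun n y => a n * f (y + IZR (- n)) + b n * g (y + IZR (- n))).
  assert (CF : forall n y, continuous (F n) y).
  { intros n y.
    apply (continuous_lincomb (fun y => f (y + IZR (- n))) (fun y => g (y + IZR (- n))));
      now apply continuous_shift. }
  set (n := Int_part x). assert (Hx := base_Int_part x). fold n in Hx.
  assert (Hn1 : IZR (n - 1) = IZR n - 1) by now rewrite minus_IZR.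
  assert (HF : F (n - 1)%Z (IZR n) = F n (IZR n)).
  { unfold F. rewrite !opp_IZR, Hn1.
    replace (IZR n + - (IZR n - 1)) with 1 by ring.
    replace (IZR n + - IZR n) with 0 by ring.
    rewrite (Hm (n - 1)%Z). now replace (n - 1 + 1)%Z with n by ring. }
  (* Near [x] only the cells [n - 1] and [n] occur. At [IZR n] the glued function takes the left
     branch and [cellwise] the right one; [HF] reconciles them. *)
  apply (continuous_ext_loc _ (fun y => if Rle_dec y (IZR n) then F (n - 1)%Z y else F n y)).
  - generalize (locally_between (IZR n - 1) (IZR n + 1) x ltac:(lra)).
    apply filter_imp. intros y Hy. destruct (Rle_dec y (IZR n)) as [Hle | Hle].
    + destruct (Req_dec y (IZR n)) as [-> | Hne].
      * rewrite HF. symmetry. apply cellwise_eq. lra.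
      * symmetry. apply cellwise_eq. lra.
    + symmetry. apply cellwise_eq. lra.
  - now apply continuous_glue.
Qed.

(** The recursion propagates the Cauchy data by the monodromy matrix, which is exactly the matching
    of [u] and [p] at the integers. *)
Lemma wsol_cellwise (m : medium) (lam : R) (c P s Q : R -> R) (a b : Z -> R) :
  fundamental m lam c P s Q ->
  (forall n, a (n + 1)%Z = a n * c 1 + b n * s 1) ->
  (forall n, b (n + 1)%Z = a n * P 1 + b n * Q 1) ->
  wsol m lam (fun _ => True) (cellwise a b c s) (cellwise a b P Q).
Proof.
  intros (H1 & H2 & c0 & P0 & s0 & Q0) Ha Hb.
  assert (HF : forall n x, locally' x (fun y => IZR n < y < IZR n + 1 ->
    ode m lam (cellwise a b c s) (cellwise a b P Q) y)).
  { intros n x.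
    destruct (wsol_lincomb _ _ _ _ _ _ _ (a n) (b n)
      (wsol_shift _ _ _ _ _ (- n) H1) (wsol_shift _ _ _ _ _ (- n) H2)) as (_ & _ & D).
    generalize (D x). apply filter_imp. intros y H Hy.
    assert (Hl : forall f g, locally y (fun z =>
      a n * f (z + IZR (- n)) + b n * g (z + IZR (- n)) = cellwise a b f g z)).
    { intros f g. generalize (locally_between _ _ _ Hy). apply filter_imp.
      intros z Hz. symmetry. apply cellwise_eq. lra. }
    eapply ode_ext; [apply Hl | apply Hl | apply H]. rewrite opp_IZR. lra. }
  split; [| split].
  - apply cellwise_continuous; [apply H1 | apply H2 |].
    intros n. rewrite c0, s0, Ha. ring.
  - apply cellwise_continuous; [apply H1 | apply H2 |].
    intros n. rewrite P0, Q0, Hb. ring.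
  - intros x. set (n := Int_part x). assert (Hx := base_Int_part x). fold n in Hx.
    generalize (filter_and _ _ (filter_and _ _ (HF (n - 1)%Z x) (HF n x))
      (filter_and _ _ (locally'_neq x (IZR n))
        (locally'_of_locally _ _ (locally_between (IZR n - 1) (IZR n + 1) x ltac:(lra))))).
    apply filter_imp. intros y [[E1 E2] [Hne Hy]] _. rewrite minus_IZR in E1.
    destruct (Rdichotomy y (IZR n) Hne); [apply E1 | apply E2]; lra.
Qed.

(** * Complex solutions as pairs of real weak solutions *)

Local Notation C_R := (prod_NormedModule R_AbsRing R_NormedModule R_NormedModule).

Lemma is_derive_fst (u : R -> R * R) (x : R) (d : R * R) :
  is_derive (V := C_R) u x d -> is_derive (fun y => fst (u y)) x (fst d).
Proof.
  intros H.
  exact (filterdiff_comp' u fst x _ fst H (filterdiff_linear fst is_linear_fst)).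
Qed.

Lemma is_derive_snd (u : R -> R * R) (x : R) (d : R * R) :
  is_derive (V := C_R) u x d -> is_derive (fun y => snd (u y)) x (snd d).
Proof.
  intros H.
  exact (filterdiff_comp' u snd x _ snd H (filterdiff_linear snd is_linear_snd)).
Qed.

Lemma is_derive_pair (f g : R -> R) (x f' g' : R) :
  is_derive f x f' -> is_derive g x g' ->
  is_derive (V := C_R) (fun y => (f y, g y)) x (f', g').
Proof.
  intros Hf Hg.
  assert (H := is_derive_plus _ _ _ _ _
    (is_derive_scal_l (V := C_R) f x f' (1, 0) Hf)
    (is_derive_scal_l (V := C_R) g x g' (0, 1) Hg)).
  assert (E : forall a b : R, plus (scal a ((1, 0) : C_R)) (scal b ((0, 1) : C_R)) = (a, b)).
  { intros a b. apply injective_projections; cbn; unfold scal; cbn; unfold mult; cbn; ring. }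
  rewrite E in H. revert H. apply is_derive_ext. intros t. apply E.
Qed.

Lemma filterlim_pair_locally {T : Type} (F : (T -> Prop) -> Prop) {FF : Filter F}
    (f g : T -> R) (a b : R) :
  filterlim f F (locally a) -> filterlim g F (locally b) ->
  filterlim (fun x => (f x, g x) : C) F (locally ((a, b) : C)).
Proof.
  intros Hf Hg. apply filterlim_locally. intros eps.
  generalize (filter_and _ _ (proj1 (filterlim_locally f a) Hf eps)
    (proj1 (filterlim_locally g b) Hg eps)).
  apply filter_imp. intros x [H1 H2]. now split.
Qed.

Lemma solves_of_wsol (m : medium) (lam : R) (u1 p1 u2 p2 : R -> R) :
  wsol m lam (fun _ => True) u1 p1 -> wsol m lam (fun _ => True) u2 p2 ->
  solves m (RtoC lam) (fun x => (u1 x, u2 x)).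
Proof.
  (* Taking [du = rho p] at boundary points as well makes the flux equal to [p] everywhere, so its
     punctured limits come from continuity. *)
  intros H1 H2. exists (fun x => (rho m x * p1 x, rho m x * p2 x)).
  assert (Hflux : forall y, (p1 y, p2 y) =
      (RtoC (/ rho m y) * (rho m y * p1 y, rho m y * p2 y)%R)%C).
  { intros y. generalize (rho_pos m y); intros Hr.
    apply injective_projections; simpl; field; lra. }
  split.
  - intros x Hx.
    destruct (wsol_ode _ _ _ _ _ H1 Hx) as [Du1 Dp1].
    destruct (wsol_ode _ _ _ _ _ H2 Hx) as [Du2 Dp2].
    split; [now apply is_derive_pair |].
    exists (- (lam / kappa m x) * u1 x, - (lam / kappa m x) * u2 x). split.
    + apply (is_derive_ext (V := C_R) (fun y => (p1 y, p2 y)));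
        [exact Hflux | now apply is_derive_pair].
    + generalize (kappa_pos m x); intros Hk.
      apply injective_projections; simpl; field; lra.
  - intros x _. destruct H1 as (Cu1 & Cp1 & _), H2 as (Cu2 & Cp2 & _). split.
    + apply (filterlim_pair_locally (locally x)); [apply Cu1 | apply Cu2].
    + exists (p1 x, p2 x).
      apply (filterlim_ext (fun y => (p1 y, p2 y))); [exact Hflux |].
      apply (filterlim_filter_le_1 (F := locally x)).
      * apply filter_le_within.
      * apply (filterlim_pair_locally (locally x)); [apply Cp1 | apply Cp2].
Qed.

Lemma continuous_fst_C (u : R -> C) (x : R) :
  continuous u x -> continuous (fun y => fst (u y)) x.
Proof. intros H. apply (continuous_comp u fst); [exact H | apply continuous_fst]. Qed.

Lemma continuous_snd_C (u : R -> C) (x : R) :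
  continuous u x -> continuous (fun y => snd (u y)) x.
Proof. intros H. apply (continuous_comp u snd); [exact H | apply continuous_snd]. Qed.

(** Here [p] is the continuous extension of the flux across the boundary, chosen pointwise as its
    punctured limit. Real and imaginary parts decouple because [lam] is real. *)
Lemma wsol_of_solves (m : medium) (lam : R) (u : R -> C) :
  solves m (RtoC lam) u ->
  exists p : R -> C,
    wsol m lam (fun _ => True) (fun x => fst (u x)) (fun x => fst (p x)) /\
    wsol m lam (fun _ => True) (fun x => snd (u x)) (fun x => snd (p x)).
Proof.
  intros (du & Hin & Hbd). set (flux := fun y => (RtoC (/ rho m y) * du y)%C) in *.
  destruct (functional_choice (fun x (f : C) =>
    (~ boundary (resonators m) x -> f = flux x) /\
    filterlim flux (locally' x) (locally f))) as [p Hp].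
  { intros x. destruct (classic (boundary (resonators m) x)) as [Hx | Hx].
    - destruct (proj2 (Hbd x Hx)) as [f Hf]. exists f. split; [contradiction | exact Hf].
    - exists (flux x). split; [reflexivity |].
      apply (filterlim_filter_le_1 (F := locally x)); [apply filter_le_within |].
      destruct (Hin x Hx) as [_ (d & Hd & _)].
      apply (ex_derive_continuous (V := C_R) flux). now exists d. }
  assert (Heq : forall x, locally' x (fun y => flux y = p y)).
  { intros x. generalize (locally'_not_boundary m x). apply filter_imp.
    intros y Hy. symmetry. now apply Hp. }
  assert (Cu : forall x, continuous u x).
  { intros x. destruct (classic (boundary (resonators m) x)) as [Hx | Hx].
    - now apply Hbd.
    - apply (ex_derive_continuous (V := C_R) u). eexists. now apply Hin. }
  assert (Cp : forall x, continuous p x).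
  { intros x P HP. apply locally_of_locally'; [now apply locally_singleton |].
    generalize (filter_and _ _ (Heq x) (proj2 (Hp x) P HP)).
    apply filter_imp. intros y [E HPy]. now rewrite <- E. }
  assert (D : forall x, locally' x (fun y =>
    is_derive (V := C_R) u y (RtoC (rho m y) * p y)%C /\
    is_derive (V := C_R) p y (RtoC (- (lam / kappa m y)) * u y)%C)).
  { intros x.
    generalize (filter_and _ _ (locally'_not_boundary m x) (locally'_locally _ _
      (locally'_not_boundary m x))).
    apply filter_imp. intros y [Hy Hly]. destruct (Hin y Hy) as [Du (d & Dd & Ed)].
    split.
    - replace (RtoC (rho m y) * p y)%C with (du y); [exact Du |].
      rewrite (proj1 (Hp y) Hy). unfold flux. rewrite Cmult_assoc, <- RtoC_mult, Rinv_r;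
        [now rewrite Cmult_1_l | generalize (rho_pos m y); lra].
    - replace (RtoC (- (lam / kappa m y)) * u y)%C with d.
      + apply (is_derive_ext_loc (V := C_R) flux); [| exact Dd].
        revert Hly. apply filter_imp. intros z Hz. symmetry. now apply Hp.
      + generalize (kappa_pos m y); intros Hk.
        assert (E1 := f_equal fst Ed). assert (E2 := f_equal snd Ed). simpl in E1, E2.
        apply injective_projections; simpl; apply (Rmult_eq_reg_l (kappa m y));
          try lra; field_simplify; lra. }
  exists p. repeat split.
  - intros x. apply continuous_fst_C, Cu.
  - intros x. apply continuous_fst_C, Cp.
  - intros x. generalize (D x). apply filter_imp. intros y [D1 D2] _. split.
    + generalize (is_derive_fst _ _ _ D1). simpl. now rewrite Rmult_0_l, Rminus_0_r.
    + generalize (is_derive_fst _ _ _ D2). simpl. now rewrite Rmult_0_l, Rminus_0_r.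
  - intros x. apply continuous_snd_C, Cu.
  - intros x. apply continuous_snd_C, Cp.
  - intros x. generalize (D x). apply filter_imp. intros y [D1 D2] _. split.
    + generalize (is_derive_snd _ _ _ D1). simpl. now rewrite Rmult_0_l, Rplus_0_r.
    + generalize (is_derive_snd _ _ _ D2). simpl. now rewrite Rmult_0_l, Rplus_0_r.
Qed.

(** * The dispersion relation *)

(** The factor in [quasiperiodic], a character of the integers generated by the Floquet multiplier
    [mu = bloch alpha beta 1]. *)
Definition bloch (alpha beta : R) (n : Z) : C :=
  Cexp (Ci * (RtoC alpha + Ci * RtoC beta) * RtoC (IZR n)).

Lemma bloch_eq (alpha beta : R) (n : Z) :
  bloch alpha beta n =
  (exp (- beta * IZR n) * cos (alpha * IZR n), exp (- beta * IZR n) * sin (alpha * IZR n)).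
Proof.
  unfold bloch, Cexp. simpl.
  replace ((0 * (alpha + (0 * beta - 1 * 0)) - 1 * (0 + (0 * 0 + 1 * beta))) * IZR n -
    (0 * (0 + (0 * 0 + 1 * beta)) + 1 * (alpha + (0 * beta - 1 * 0))) * 0)
    with (- beta * IZR n) by ring.
  replace ((0 * (alpha + (0 * beta - 1 * 0)) - 1 * (0 + (0 * 0 + 1 * beta))) * 0 +
    (0 * (0 + (0 * 0 + 1 * beta)) + 1 * (alpha + (0 * beta - 1 * 0))) * IZR n)
    with (alpha * IZR n) by ring.
  reflexivity.
Qed.

Lemma bloch_0 (alpha beta : R) : bloch alpha beta 0 = RtoC 1.
Proof.
  rewrite bloch_eq, !Rmult_0_r, exp_0, cos_0, sin_0.
  apply injective_projections; simpl; ring.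
Qed.

Lemma bloch_add (alpha beta : R) (k n : Z) :
  bloch alpha beta (k + n) = (bloch alpha beta k * bloch alpha beta n)%C.
Proof.
  rewrite !bloch_eq, plus_IZR, !Rmult_plus_distr_l, exp_plus, cos_plus, sin_plus.
  apply injective_projections; simpl; ring.
Qed.

Lemma bloch_1 (alpha beta : R) :
  bloch alpha beta 1 = (exp (- beta) * cos alpha, exp (- beta) * sin alpha).
Proof. now rewrite bloch_eq, !Rmult_1_r. Qed.

(** If the first row is nonzero, [(- b, a)] works, the determinant being its product with the second
    row. A zero first row and a zero matrix are treated apart. *)
Lemma kernel_vector (a b c d : C) :
  (a * d - b * c = 0)%C ->
  exists x y : C, ~ (x = 0 /\ y = 0) /\ (a * x + b * y = 0)%C /\ (c * x + d * y = 0)%C.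
Proof.
  intros Hdet.
  assert (Hopp : forall z : C, (- z = 0)%C -> z = 0).
  { intros z Hz. replace z with (- - z)%C by ring. rewrite Hz. ring. }
  destruct (classic (a = 0 /\ b = 0)) as [[Ha Hb] | Hab].
  - destruct (classic (c = 0 /\ d = 0)) as [[Hc Hd] | Hcd].
    + exists 1, 0. rewrite Ha, Hb, Hc, Hd. repeat split; try ring.
      intros [H1 _]. apply RtoC_inj in H1. lra.
    + exists (- d)%C, c. rewrite Ha, Hb. repeat split; try ring.
      intros [H1 H2]. apply Hcd. split; [exact H2 | now apply Hopp].
  - exists (- b)%C, a. repeat split; [| ring |].
    + intros [H1 H2]. apply Hab. split; [exact H2 | now apply Hopp].
    + rewrite <- Hdet. ring.
Qed.

(** With [mu = e (co + i si)] and [1 / mu = f (co - i si)], one side splits [mu^2 - D mu + 1 = 0]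
    into real and imaginary parts, the other [mu + 1 / mu = D]. *)
Lemma char_poly_unimodular_form (e f co si D : R) :
  e * f = 1 -> co * co + si * si = 1 ->
  ((e * co) * (e * co) - (e * si) * (e * si) - D * (e * co) + 1 = 0 /\
   2 * (e * co) * (e * si) - D * (e * si) = 0) <->
  ((e + f) * co = D /\ (e - f) * si = 0).
Proof.
  intros Hef Hcs. split; intros [H1 H2].
  (* [K1] and [K2] are the real and imaginary parts of the polynomial times the conjugate of [mu];
     the factor [e * e] is [|mu|^2]. *)
  - assert (K1 : e * e * ((e + f) * co - D) = 0).
    { transitivity ((e * co) * ((e * co) * (e * co) - (e * si) * (e * si) - D * (e * co) + 1)
        + (e * si) * (2 * (e * co) * (e * si) - D * (e * si))
        + e * co * (e * f - 1)
        + (e * e * D - e * e * e * co) * (co * co + si * si - 1)); [ring |].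
      rewrite H1, H2, Hef, Hcs. ring. }
    assert (K2 : e * e * ((e - f) * si) = 0).
    { transitivity ((e * co) * (2 * (e * co) * (e * si) - D * (e * si))
        - (e * si) * ((e * co) * (e * co) - (e * si) * (e * si) - D * (e * co) + 1)
        - e * si * (e * f - 1)
        - (e * e * e * si) * (co * co + si * si - 1)); [ring |].
      rewrite H1, H2, Hef, Hcs. ring. }
    assert (e <> 0) by (intros ->; lra).
    assert (e * e <> 0) by now apply Rmult_integral_contrapositive.
    split.
    + apply Rmult_integral in K1. lra.
    + apply Rmult_integral in K2. lra.
  - rewrite <- H1. split.
    + transitivity (1 - e * f + e * f * (1 - (co * co + si * si))
        - (e * si) * ((e - f) * si)); [ring |].
      rewrite H2, Hef, Hcs. ring.
    + transitivity (e * co * ((e - f) * si)); [ring |]. rewrite H2. ring.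
Qed.

(** The eigenvector is [(u 0, p 0)]. Its second equation needs [p 1 = mu p 0], which holds because
    [u (x + 1) - mu u x] vanishes identically and hence so does its flux. *)
Lemma eigenvector_of_sigma_at (m : medium) (lam alpha beta : R) (c P s Q : R -> R) :
  fundamental m lam c P s Q -> sigma_at m alpha beta (RtoC lam) ->
  exists A B : C, ~ (A = 0 /\ B = 0) /\
    (RtoC (c 1) * A + RtoC (s 1) * B = bloch alpha beta 1 * A)%C /\
    (RtoC (P 1) * A + RtoC (Q 1) * B = bloch alpha beta 1 * B)%C.
Proof.
  intros HF (u & [x0 Hx0] & Hsol & Hq).
  destruct (wsol_of_solves _ _ _ Hsol) as (p & W1 & W2).
  set (mu := bloch alpha beta 1).
  assert (Hu1 : forall x, u (x + 1) = (mu * u x)%C) by (intros x; apply (Hq 1%Z)).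
  clearbody mu.
  assert (Hp1 : p 1 = (mu * p 0)%C).
  { assert (S1 := wsol_shift _ _ _ _ _ 1 W1). assert (S2 := wsol_shift _ _ _ _ _ 1 W2).
    simpl in S1, S2.
    (* Multiplication by [mu] mixes the two real solutions, so each component of the difference is a
       real combination of three of them. *)
    assert (L1 := wsol_lincomb _ _ _ _ _ _ _ 1 (-1) S1
      (wsol_lincomb _ _ _ _ _ _ _ (fst mu) (- snd mu) W1 W2)).
    assert (L2 := wsol_lincomb _ _ _ _ _ _ _ 1 (-1) S2
      (wsol_lincomb _ _ _ _ _ _ _ (snd mu) (fst mu) W1 W2)).
    assert (Z1 := wsol_flux_zero _ _ _ _ L1). assert (Z2 := wsol_flux_zero _ _ _ _ L2).
    cbv beta in Z1, Z2.
    rewrite <- (Rplus_0_l 1).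
    apply injective_projections; simpl.
    - assert (1 * fst (p (0 + 1)) + -1 * (fst mu * fst (p 0) + - snd mu * snd (p 0)) = 0);
        [| lra].
      apply Z1. intros x. rewrite Hu1. simpl. ring.
    - assert (1 * snd (p (0 + 1)) + -1 * (snd mu * fst (p 0) + fst mu * snd (p 0)) = 0);
        [| lra].
      apply Z2. intros x. rewrite Hu1. simpl. ring. }
  assert (Hspan : forall x, 0 <= x <= 1 ->
    u x = (RtoC (c x) * u 0 + RtoC (s x) * p 0)%C /\
    p x = (RtoC (P x) * u 0 + RtoC (Q x) * p 0)%C).
  { intros x Hx.
    destruct (fundamental_span _ _ _ _ _ _ _ _ HF (wsol_subset _ _ _ _ _ _ (fun _ _ => I) W1)
      x Hx) as [E1 E2].
    destruct (fundamental_span _ _ _ _ _ _ _ _ HF (wsol_subset _ _ _ _ _ _ (fun _ _ => I) W2)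
      x Hx) as [E3 E4].
    split; apply injective_projections; simpl; lra. }
  exists (u 0), (p 0). split; [| split].
  (* Zero data at 0 would make [u] vanish on the cell, and by quasiperiodicity at [x0]. *)
  - intros [HA HB]. apply Hx0.
    assert (Hx := base_Int_part x0). set (n := Int_part x0) in *.
    replace x0 with (x0 - IZR n + IZR n) by ring. rewrite Hq.
    rewrite (proj1 (Hspan (x0 - IZR n) ltac:(lra))), HA, HB. ring.
  - rewrite <- (proj1 (Hspan 1 ltac:(lra))), <- Hu1. now rewrite Rplus_0_l.
  - rewrite <- (proj2 (Hspan 1 ltac:(lra))). exact Hp1.
Qed.

(** The solution with Cauchy data [mu^n (A, B)] at each integer [n]; the eigenvector equations are
    the recursion that glues the cells. *)
Lemma sigma_at_of_eigenvector (m : medium) (lam alpha beta : R) (c P s Q : R -> R)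
    (A B : C) :
  fundamental m lam c P s Q -> ~ (A = 0 /\ B = 0) ->
  (RtoC (c 1) * A + RtoC (s 1) * B = bloch alpha beta 1 * A)%C ->
  (RtoC (P 1) * A + RtoC (Q 1) * B = bloch alpha beta 1 * B)%C ->
  sigma_at m alpha beta (RtoC lam).
Proof.
  intros HF Hnz HA HB.
  set (E := bloch alpha beta) in *.
  set (a := fun n => (E n * A)%C). set (b := fun n => (E n * B)%C).
  assert (Ha : forall n, a (n + 1)%Z = (RtoC (c 1) * a n + RtoC (s 1) * b n)%C).
  { intros n. unfold a, b, E. rewrite bloch_add. fold E.
    rewrite <- Cmult_assoc, <- HA. ring. }
  assert (Hb : forall n, b (n + 1)%Z = (RtoC (P 1) * a n + RtoC (Q 1) * b n)%C).
  { intros n. unfold a, b, E. rewrite bloch_add. fold E.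
    rewrite <- Cmult_assoc, <- HB. ring. }
  assert (W1 : wsol m lam (fun _ => True)
    (cellwise (fun n => fst (a n)) (fun n => fst (b n)) c s)
    (cellwise (fun n => fst (a n)) (fun n => fst (b n)) P Q)).
  { apply wsol_cellwise; [exact HF | |]; intros n; [rewrite Ha | rewrite Hb]; simpl; ring. }
  assert (W2 : wsol m lam (fun _ => True)
    (cellwise (fun n => snd (a n)) (fun n => snd (b n)) c s)
    (cellwise (fun n => snd (a n)) (fun n => snd (b n)) P Q)).
  { apply wsol_cellwise; [exact HF | |]; intros n; [rewrite Ha | rewrite Hb]; simpl; ring. }
  exists (fun x => (cellwise (fun n => fst (a n)) (fun n => fst (b n)) c s x,
               cellwise (fun n => snd (a n)) (fun n => snd (b n)) c s x)).
  split; [| split].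
  (* Since [A] alone may be zero, [u] at 0 does not suffice: if [u] vanished, its flux would too,
     forcing [A = B = 0]. *)
  - apply NNPP. intros Hno.
    assert (Hz : forall x, (cellwise (fun n => fst (a n)) (fun n => fst (b n)) c s x,
               cellwise (fun n => snd (a n)) (fun n => snd (b n)) c s x) = RtoC 0).
    { intros x. apply NNPP. intros Hx. apply Hno. now exists x. }
    assert (Z1 := wsol_flux_zero _ _ _ _ W1 (fun x => f_equal fst (Hz x)) 0).
    assert (Z2 := wsol_flux_zero _ _ _ _ W2 (fun x => f_equal snd (Hz x)) 0).
    assert (Z3 : cellwise (fun n => fst (a n)) (fun n => fst (b n)) c s 0 = 0)
      by exact (f_equal fst (Hz 0)).
    assert (Z4 : cellwise (fun n => snd (a n)) (fun n => snd (b n)) c s 0 = 0)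
      by exact (f_equal snd (Hz 0)).
    destruct HF as (_ & _ & c0 & P0 & s0 & Q0).
    assert (H0 : forall f g h k, cellwise f g h k 0 = f 0%Z * h 0 + g 0%Z * k 0).
    { intros f g h k. rewrite (cellwise_eq _ _ _ _ _ 0) by lra. simpl. now rewrite Rplus_0_r. }
    assert (Ha0 : a 0%Z = A) by (unfold a, E; rewrite bloch_0; ring).
    assert (Hb0 : b 0%Z = B) by (unfold b, E; rewrite bloch_0; ring).
    rewrite H0, Ha0, Hb0 in Z1. rewrite H0, Ha0, Hb0 in Z2.
    rewrite H0, Ha0, Hb0 in Z3. rewrite H0, Ha0, Hb0 in Z4.
    rewrite P0, Q0 in Z1, Z2. rewrite c0, s0 in Z3, Z4.
    apply Hnz. split; apply injective_projections; simpl; lra.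
  - now apply solves_of_wsol with
      (p1 := cellwise (fun n => fst (a n)) (fun n => fst (b n)) P Q)
      (p2 := cellwise (fun n => snd (a n)) (fun n => snd (b n)) P Q).
  - intros l x. unfold cellwise. rewrite Int_part_add. fold (bloch alpha beta l). fold E.
    set (n := Int_part x).
    replace (x + IZR l + IZR (- (n + l))) with (x + IZR (- n))
      by (rewrite !opp_IZR, plus_IZR; ring).
    unfold a, b, E. rewrite bloch_add.
    apply injective_projections; simpl; ring.
Qed.

Lemma quadratic_components (z : C) (d : R) :
  (z * z - RtoC d * z + 1)%C = 0 <->
  fst z * fst z - snd z * snd z - d * fst z + 1 = 0 /\
  2 * fst z * snd z - d * snd z = 0.
Proof.
  split.
  - intros H. assert (H1 := f_equal fst H). assert (H2 := f_equal snd H).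
    simpl in H1, H2. split; lra.
  - intros [H1 H2]. apply injective_projections; simpl; lra.
Qed.

Lemma sigma_at_iff (m : medium) (lam alpha beta : R) (c P s Q : R -> R) :
  fundamental m lam c P s Q ->
  sigma_at m alpha beta (RtoC lam) <->
  (exp (- beta) + exp beta) * cos alpha = c 1 + Q 1 /\
  (exp (- beta) - exp beta) * sin alpha = 0.
Proof.
  intros HF. assert (Hdet := fundamental_det _ _ _ _ _ _ HF 1 ltac:(lra)).
  rewrite <- char_poly_unimodular_form;
    [| rewrite <- exp_plus, Rplus_opp_l; apply exp_0
     | generalize (sin2_cos2 alpha); unfold Rsqr; lra].
  set (mu := bloch alpha beta 1).
  assert (Hmu1 : fst mu = exp (- beta) * cos alpha) by (unfold mu; now rewrite bloch_1).
  assert (Hmu2 : snd mu = exp (- beta) * sin alpha) by (unfold mu; now rewrite bloch_1).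
  rewrite <- Hmu1, <- Hmu2.
  rewrite <- quadratic_components.
  assert (HC : (mu * mu - RtoC (c 1 + Q 1) * mu + 1 =
    (RtoC (c 1) - mu) * (RtoC (Q 1) - mu) - RtoC (s 1) * RtoC (P 1))%C).
  { replace (RtoC 1) with (RtoC (c 1 * Q 1 - s 1 * P 1)) by now rewrite Hdet.
    rewrite RtoC_minus, RtoC_plus, !RtoC_mult. ring. }
  rewrite HC. split.
  - intros H. destruct (eigenvector_of_sigma_at _ _ _ _ _ _ _ _ HF H) as (A & B & Hnz & HA & HB).
    fold mu in HA, HB.
    apply NNPP. intros Hd. apply Hnz.
    (* Applying the adjugate of the monodromy matrix minus [mu] to the eigenvector equations
       multiplies [A] and [B] by the determinant. *)
    assert (K1 : (((RtoC (c 1) - mu) * (RtoC (Q 1) - mu) - RtoC (s 1) * RtoC (P 1)) * A)%C = 0).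
    { transitivity ((RtoC (Q 1) - mu) * (RtoC (c 1) * A + RtoC (s 1) * B - mu * A)
        - RtoC (s 1) * (RtoC (P 1) * A + RtoC (Q 1) * B - mu * B))%C; [ring |].
      rewrite HA, HB. ring. }
    assert (K2 : (((RtoC (c 1) - mu) * (RtoC (Q 1) - mu) - RtoC (s 1) * RtoC (P 1)) * B)%C = 0).
    { transitivity ((RtoC (c 1) - mu) * (RtoC (P 1) * A + RtoC (Q 1) * B - mu * B)
        - RtoC (P 1) * (RtoC (c 1) * A + RtoC (s 1) * B - mu * A))%C; [ring |].
      rewrite HA, HB. ring. }
    split; apply NNPP; intros Hne.
    + now apply (Cmult_neq_0 _ _ Hd Hne).
    + now apply (Cmult_neq_0 _ _ Hd Hne).
  - intros Hd. destruct (kernel_vector _ _ _ _ Hd) as (A & B & Hnz & HA & HB).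
    apply (sigma_at_of_eigenvector m lam alpha beta c P s Q A B HF Hnz); fold mu.
    + transitivity ((RtoC (c 1) - mu) * A + RtoC (s 1) * B + mu * A)%C; [ring |].
      rewrite HA. ring.
    + transitivity (RtoC (P 1) * A + (RtoC (Q 1) - mu) * B + mu * B)%C; [ring |].
      rewrite HB. ring.
Qed.

(** * The range of twice the hyperbolic cosine, and the conclusion *)

Lemma exp_plus_exp_opp_gt_2 (x : R) : x <> 0 -> 2 < exp (- x) + exp x.
Proof.
  intros Hx.
  assert (H1 := exp_ineq1 x Hx). assert (H2 := exp_ineq1 (- x) ltac:(lra)). lra.
Qed.

Lemma exp_plus_exp_opp_onto (d : R) :
  2 < d -> exists x, x <> 0 /\ exp (- x) + exp x = d.
Proof.
  intros Hd.
  assert (Hs : 0 < sqrt (d * d - 4)) by (apply sqrt_lt_R0; nra).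
  assert (Hs2 : sqrt (d * d - 4) * sqrt (d * d - 4) = d * d - 4) by (apply sqrt_sqrt; nra).
  (* The larger root of [r^2 - d r + 1], that is of [1 / r + r = d]; being above 1, it has a nonzero
     logarithm. *)
  set (r := (d + sqrt (d * d - 4)) / 2).
  assert (Hr : 1 < r) by (unfold r; lra).
  exists (ln r). split.
  - assert (0 < ln r) by (rewrite <- ln_1; apply ln_increasing; lra). lra.
  - rewrite exp_Ropp, exp_ln by lra.
    apply (Rmult_eq_reg_l r); [| lra]. field_simplify; [| lra].
    unfold r. nra.
Qed.

Theorem theorem2p11 (m : medium) :
  forall lambda : R,
    resolvent m lambda <->
    exists alpha beta : R, Btilde alpha beta /\ sigma_at m alpha beta (RtoC lambda).
Proof.
  intros lambda.
  destruct (fundamental_exists m lambda) as (c & P & s & Q & HF).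
  assert (Hiff := fun alpha beta => sigma_at_iff m lambda alpha beta c P s Q HF).
  set (D := c 1 + Q 1) in *.
  assert (Hsig : Defs.sigma m (RtoC lambda) <-> -2 <= D <= 2).
  { split.
    - intros (alpha & _ & H). apply Hiff in H. destruct H as [H _].
      rewrite Ropp_0, exp_0 in H. generalize (COS_bound alpha). lra.
    - intros HD. exists (acos (D / 2)).
      assert (Hb := acos_bound (D / 2)). split; [lra |].
      apply Hiff. rewrite Ropp_0, exp_0, cos_acos by lra. split; field. }
  unfold resolvent. rewrite Hsig. split.
  (* The sign of the trace selects [alpha]: 0 if [D > 2], and [PI] if [D < -2], where the cosine
     changes the sign. *)
  - intros HD. destruct (Rlt_or_le 2 D) as [H2 | H2].
    + destruct (exp_plus_exp_opp_onto D H2) as (beta & Hb & He).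
      exists 0, beta. split; [split; [lra | exact Hb] |].
      apply Hiff. rewrite cos_0, sin_0, He. split; ring.
    + destruct (exp_plus_exp_opp_onto (- D) ltac:(lra)) as (beta & Hb & He).
      exists PI, beta. split; [split; [lra | exact Hb] |].
      apply Hiff. rewrite cos_PI, sin_PI, He. split; ring.
  - intros (alpha & beta & [Ha Hb] & H) HD. apply Hiff in H. destruct H as [H _].
    generalize (exp_plus_exp_opp_gt_2 beta Hb). intros H2.
    destruct Ha as [-> | [-> | ->]].
    + rewrite cos_neg, cos_PI in H. lra.
    + rewrite cos_0 in H. lra.
    + rewrite cos_PI in H. lra.
Qed.
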